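(* Let $X$ and $Y$ be nonempty perfect Polish spaces, and let $A$ be a dense $G_\delta$ subset of $X\times Y$. Then there exist a dense $G_\delta$ subset $F$ of $X$, a dense $G_\delta$ subset $G$ of $Y$, and a homeomorphism $f$ from $F$ onto $G$ whose graph is contained in $A$; moreover, $F$ can be taken homeomorphic to $\omega^\omega$.
   Context: Perfect means without isolated points. $\omega^\omega$ is the Baire space. *)

(* Defs.v *)
From HB Require Import structures.
From mathcomp Require Import all_boot all_order all_algebra.
From mathcomp Require Import all_classical all_reals topology borel_hierarchy.

Set Implicit Arguments.
Unset Strict Implicit.
Unset Printing Implicit Defensive.

Local Open Scope classical_set_scope.

Definition homeomorphism (T U : topologicalType) (f : T -> U) : Prop :=
  continuous f /\
  exists g : U -> T, [/\ continuous g, cancel f g & cancel g f].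

Definition homeomorphic (T U : topologicalType) : Prop :=
  exists f : T -> U, homeomorphism f.

Definition separable (T : topologicalType) : Prop :=
  exists2 D : set T, countable D & dense D.

(* [completeType] is not used because it requires a point, whereas a Polish
   space may be empty. *)
Definition complete_metric (R : realType) (M : metricType R) : Prop :=
  forall F : set_system M, ProperFilter F -> cauchy F ->
    exists x : M, F --> x.

Definition completely_metrizable (R : realType) (T : topologicalType) : Prop :=
  exists2 M : metricType R, complete_metric M & homeomorphic T M.

Definition polish (R : realType) (T : topologicalType) : Prop :=
  separable T /\ completely_metrizable R T.

Definition perfect_space (T : topologicalType) : Prop :=
  isolated [set: T] = set0.

(* The library topology on [nat] is the discrete one. *)
Definition baire_space : Type := prod_topology (fun _ : nat => nat).

HB.instance Definition _ :=
  Topological.copy baire_space (prod_topology (fun _ : nat => nat)).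

(* Main.v *)
Require Import Defs.
From mathcomp Require Import all_boot all_order all_algebra.
From mathcomp Require Import all_classical all_reals topology borel_hierarchy.

Local Open Scope classical_set_scope.

Import Order.TTheory GRing.Theory Num.Theory.

(** The homeomorphism is obtained by carrying out one and the same tree
    construction in X and in Y. Write A as the intersection of open sets E n;
    each E n is dense because A is. Nonempty open sets U s of X and V s of Y are
    indexed by finite sequences s of naturals: the roots are the whole spaces,
    and the children of a node s of length n are pairwise disjoint, of diameter
    at most 1/(n+1), have closures inside the parent, have a union dense in the
    parent, and satisfy: the product of the i-th child of U s with the i-th
    child of V s lies in E n.

    Such a pair of trees yields everything. By completeness the sets along an
    infinite branch b shrink to a single point, so b |-> that point is a
    homeomorphism of the Baire space onto the set of points that belong to some
    node at every level (scheme_homeomorphism); this set is a dense G_delta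
    (scheme_set_dense, scheme_set_Gdelta). Calling it F in X and G in Y, the map
    f sends the point of F with branch b to the point of G with branch b, and
    the pair of both points is in U s x V s for every stem s of b, hence in
    every E n.

    The children are produced by a simultaneous greedy choice (pair_splits).
    At step k there remain open regions W of U s and Z of V s. Since E n is
    dense and open, it contains a product of two small open sets, the first
    inside W and the second inside Z, and they may be taken inside the k-th
    members of given countable pi-bases whenever these members meet W and Z. As
    no point is isolated, the two sets can be chosen so small that removing
    their closures leaves nonempty regions, so that the choice never stops, and
    handling all members of the pi-bases makes both families dense
    (greedy_splits).

    Of the Polish topologies only three consequences enter: points are closed,
    there is a countable pi-base, and there is a sequence of smallness predicates
    with the properties collected in complete_development. They are read off from
    a complete metric space homeomorphic to the given one
    (polish_development). *)

(** * Developments, schemes and branches *)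

Definition pi_base {T : topologicalType} (B : nat -> set T) : Prop :=
  (forall k, open (B k)) /\
  forall O, open O -> O !=set0 -> exists k, B k !=set0 /\ B k `<=` O.

(** The topological content of a complete metric, with small n V read as: V has
    diameter at most 1/(n+1). In dev_nbhs it is not enough to treat the V
    that contain x: density of scheme sets needs all V that meet a fixed
    neighbourhood of x. *)
Record complete_development {T : topologicalType}
    (small : nat -> set T -> Prop) : Prop := CompleteDevelopment {
  dev_shrink : forall n (x : T) (O : set T), nbhs x O ->
    exists V, [/\ open V, V x, closure V `<=` O & small n V] ;
  dev_nbhs : forall (x : T) (O : set T), nbhs x O ->
    exists n, exists2 P, nbhs x P &
      forall V, small n V -> V `&` P !=set0 -> V `<=` O ;
  dev_complete : forall U : nat -> set T, (forall n, U n !=set0) ->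
    (forall n, closure (U n.+1) `<=` U n) -> (forall n, small n (U n.+1)) ->
    exists x, forall n, U n x }.

Definition splits {T : topologicalType} (small : nat -> set T -> Prop)
    (n : nat) (U : set T) (u : nat -> set T) : Prop :=
  [/\ forall i, open (u i) /\ u i !=set0,
      forall i, closure (u i) `<=` U,
      forall i, small n (u i),
      forall i j, u i `&` u j !=set0 -> i = j &
      forall O, open O -> O `&` U !=set0 -> exists i, O `&` u i !=set0].

(** A node is written from its last entry to its first, so that i :: s is the
    i-th child of s. *)
Definition dense_scheme {T : topologicalType} (small : nat -> set T -> Prop)
    (U : seq nat -> set T) : Prop :=
  U [::] = [set: T] /\
  forall s, splits small (size s) (U s) (fun i => U (i :: s)).

(** The first n values of b in reversed order, matching the way in which the
    nodes of a scheme are written. *)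
Fixpoint stem (b : nat -> nat) (n : nat) : seq nat :=
  if n is m.+1 then b m :: stem b m else [::].

Lemma size_stem b n : size (stem b n) = n.
Proof. by elim: n => //= n ->. Qed.

Lemma eq_stem b c n : (forall k, (k < n)%N -> b k = c k) -> stem b n = stem c n.
Proof.
elim: n => //= n IH bc; rewrite bc// IH// => k kn.
by apply: bc; exact: ltnW.
Qed.

Lemma stem_surj s : exists b, stem b (size s) = s.
Proof.
elim: s => [|i s [b bs]]; first by exists (fun=> 0%N).
exists (fun k => if k == size s then i else b k) => /=.
rewrite eqxx; congr cons; rewrite -[RHS]bs; apply: eq_stem => k ks.
by rewrite ltn_eqF.
Qed.

Definition scheme_set {T : Type} (U : seq nat -> set T) : set T :=
  \bigcap_n \bigcup_(s in [set s | size s = n]) U s.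

(** * Polish spaces have complete developments *)

Section PolishDevelopment.
Variables (R : realType) (T : topologicalType) (M : metricType R).
Variables (phi : T -> M) (psi : M -> T).
Hypotheses (phi_cont : continuous phi) (psi_cont : continuous psi).
Hypotheses (phiK : cancel phi psi) (psiK : cancel psi phi).

Let r (n : nat) : R := (n.+1%:R^-1)%R.

Let r_gt0 n : (0 < r n)%R.
Proof. by rewrite /r invr_gt0 ltr0n. Qed.

Let r_lt (e : R) : (0 < e)%R -> exists n, (r n < e)%R.
Proof.
by move=> /ltr_add_invr[n]; rewrite add0r; exists n.
Qed.

Lemma nbhs_pullback_ball x (e : R) : (0 < e)%R ->
  nbhs x [set y | ball (phi x) e (phi y)].
Proof. by move=> e0; apply: phi_cont; exact: nbhsx_ballx. Qed.

Lemma nbhs_contains_ball x O : nbhs x O ->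
  exists2 e : R, (0 < e)%R & forall y, ball (phi x) e (phi y) -> O y.
Proof.
move=> Ox; have : nbhs (phi x) (psi @^-1` O).
  by apply: psi_cont; rewrite phiK.
move=> /nbhs_ballP[e /= e0 eO]; exists e => // y /eO /=.
by rewrite phiK.
Qed.

Definition pullback_ball x (e : R) : set T := phi @^-1` (ball (phi x) e)^°.

Lemma open_pullback_ball x e : open (pullback_ball x e).
Proof. by move/continuousP : phi_cont; apply; exact: open_interior. Qed.

Lemma pullback_ball_center x e : (0 < e)%R -> pullback_ball x e x.
Proof. by move=> e0; exact: nbhsx_ballx. Qed.

Lemma pullback_ballW x e y : pullback_ball x e y -> ball (phi x) e (phi y).
Proof. exact: interior_subset. Qed.

Definition small_diameter (n : nat) (V : set T) : Prop :=
  forall x y, V x -> V y -> ball (phi x) (r n) (phi y).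

(** For dev_complete, the images of the U n generate a Cauchy filter; its limit
    lies in every U n because it adheres to U (n+1). *)
Lemma complete_metric_development : complete_metric M ->
  complete_development small_diameter.
Proof.
move=> Mcomplete; split.
- move=> n x O /nbhs_contains_ball[e e0 eO].
  pose d := (Num.min e (r n) / 2)%R.
  have d0 : (0 < d)%R by rewrite divr_gt0// lt_min e0 r_gt0.
  have dd : (d + d = Num.min e (r n))%R by rewrite -splitr.
  exists (pullback_ball x d); split.
  + exact: open_pullback_ball.
  + exact: pullback_ball_center.
  + move=> y /(_ _ (nbhs_pullback_ball y d d0))[z [/pullback_ballW xz yz]].
    apply: eO; apply: (@le_ball _ _ _ (d + d)%R).
      by rewrite dd ge_min lexx.
    exact: ball_triangle xz (ball_sym yz).
  + move=> y z /pullback_ballW xy /pullback_ballW xz.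
    apply: (@le_ball _ _ _ (d + d)%R); first by rewrite dd ge_min lexx orbT.
    exact: ball_triangle (ball_sym xy) xz.
- move=> x O /nbhs_contains_ball[e e0 eO].
  have e20 : (0 < e / 2)%R by rewrite divr_gt0.
  have [n ne] := r_lt _ e20.
  exists n, [set y | ball (phi x) (e / 2) (phi y)].
    exact: nbhs_pullback_ball.
  move=> V Vn [z [Vz xz]] y Vy; apply: eO; rewrite (splitr e).
  exact: ball_triangle xz (le_ball (ltW ne) (Vn _ _ Vz Vy)).
- move=> U U0 Ucl Usmall.
  have Umono m k : (m <= k)%N -> U k `<=` U m.
    move=> /subnK <-; elim: (k - m)%N => [|i IH] //.
    apply: subset_trans IH; rewrite addSn.
    exact: subset_trans (@subset_closure _ _) (Ucl _).
  pose F : set_system M := filter_from [set: nat] (fun n => phi @` U n).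
  have FF : ProperFilter F.
    apply: filter_from_proper; last first.
      by move=> i _; have [x Ux] := U0 i; exists (phi x), x.
    apply: filter_from_filter; first by exists 0%N.
    move=> i j _ _; exists (maxn i j) => // _ [x Ux <-].
    by split; exists x => //; apply: Umono Ux; rewrite ?leq_maxl ?leq_maxr.
  have Fcauchy : cauchy F.
    apply: cauchy_exP => e e0; have [n ne] := r_lt _ e0.
    have [x Ux] := U0 n.+1; exists (phi x); exists n.+1 => // _ [y Uy <-].
    exact: le_ball (ltW ne) _ (Usmall _ _ _ Ux Uy).
  have [m Fm] := Mcomplete F FF Fcauchy.
  exists (psi m) => n; apply: Ucl => O /psi_cont /Fm[k _ kO].
  have [x Ux] := U0 (maxn n.+1 k); exists x; split.
    by apply: Umono Ux; rewrite leq_maxl.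
  have /kO /= : (phi @` U k) (phi x).
    by exists x => //; apply: Umono Ux; rewrite leq_maxr.
  by rewrite phiK.
Qed.

Lemma metric_accessible : accessible_space T.
Proof.
apply: hausdorff_accessible => x y xy; apply: (can_inj phiK).
apply: (@metric_hausdorff _ M) => A B /phi_cont Ax /phi_cont By.
by have [z [Az Bz]] := xy _ _ Ax By; exists (phi z).
Qed.

(** The balls of radius 1/(j+1) around the points of a countable dense set. The
    point x0 only completes the enumeration d of that set to a total function. *)
Lemma separable_pi_base : [set: T] !=set0 -> separable T ->
  exists B : nat -> set T, pi_base B.
Proof.
move=> [x0 _] [D /countable_injP[c c_inj] Ddense].
pose d k := xget x0 [set x | D x /\ c x = k].
have dc x : D x -> d (c x) = x.
  move=> Dx; rewrite /d; case: xgetP => [y _ [Dy cy]|/(_ x)[]//].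
  by apply: c_inj; rewrite ?inE.
pose B k := if unpickle k is Some (i, j) then pullback_ball (d i) (r j)
            else set0.
exists B; split.
  move=> k; rewrite /B; case: unpickle => [[i j]|]; last exact: open0.
  exact: open_pullback_ball.
move=> O Oopen [x Ox].
have [e e0 eO] := nbhs_contains_ball _ _ (open_nbhs_nbhs (conj Oopen Ox)).
have e20 : (0 < e / 2)%R by rewrite divr_gt0.
have [j je] := r_lt _ e20.
have [||p [xp Dp]] := Ddense (pullback_ball x (r j)).
- by exists x; exact: pullback_ball_center.
- exact: open_pullback_ball.
exists (pickle (c p, j)); rewrite /B pickleK dc//; split.
  by exists p; exact: pullback_ball_center.
move=> y /pullback_ballW py; apply: eO; rewrite (splitr e).
apply: ball_triangle (le_ball (ltW je) py).
apply: le_ball (ltW je) _ _; exact: pullback_ballW xp.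
Qed.

End PolishDevelopment.

Lemma polish_development (R : realType) (T : topologicalType) :
  [set: T] !=set0 -> polish R T ->
  [/\ accessible_space T,
      exists small : nat -> set T -> Prop, complete_development small &
      exists B : nat -> set T, pi_base B].
Proof.
move=> T0 [sepT [M Mcomplete [phi [phi_cont [psi [psi_cont phiK psiK]]]]]].
split.
- exact: metric_accessible phi_cont phiK.
- by exists (small_diameter R T M phi); exact: complete_metric_development.
- exact: separable_pi_base phi_cont psi_cont phiK T0 sepT.
Qed.

(** * A dense scheme parametrizes a dense G_delta by the Baire space *)

Section SchemeHomeomorphism.
Context {T : topologicalType} {small : nat -> set T -> Prop}.
Hypotheses (T1 : accessible_space T) (dev : complete_development small).
Hypothesis T0 : [set: T] !=set0.
Variable U : seq nat -> set T.
Hypothesis schemeU : dense_scheme small U.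

Lemma scheme_open s : open (U s).
Proof.
case: schemeU => U_root split; case: s => [|i s].
  by rewrite U_root; exact: openT.
by have [/(_ i)[]] := split s.
Qed.

Lemma scheme_neq0 s : U s !=set0.
Proof.
case: schemeU => U_root split; case: s => [|i s]; first by rewrite U_root.
by have [/(_ i)[]] := split s.
Qed.

Lemma scheme_sub i s : U (i :: s) `<=` U s.
Proof.
have [_ /(_ s)[_ /(_ i) clU _ _ _]] := schemeU.
exact: subset_trans (@subset_closure _ _) clU.
Qed.

Lemma scheme_inj s t x : size s = size t -> U s x -> U t x -> s = t.
Proof.
elim: s t => [|i s IH] [|j t] //= [st] Usx Utx.
have est : s = t by apply: IH => //; apply: scheme_sub; eassumption.
rewrite -est in Utx *; congr cons.
by have [_ /(_ s)[_ _ _ disj _]] := schemeU; apply: disj; exists x.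
Qed.

Lemma scheme_level_dense n O : open O -> O !=set0 ->
  exists2 s, size s = n & O `&` U s !=set0.
Proof.
move=> Oopen [x Ox]; elim: n => [|n [s sn Os]].
  by exists [::] => //; exists x; split=> //; case: schemeU => ->.
have [_ /(_ s)[_ _ _ _ dns]] := schemeU.
by have [i Oi] := dns O Oopen Os; exists (i :: s) => //=; rewrite sn.
Qed.

Lemma scheme_branch b : exists x, forall n, U (stem b n) x.
Proof.
have [_ split] := schemeU.
apply: (dev_complete _ dev (fun n => U (stem b n))) => n.
- exact: scheme_neq0.
- by have [_ cl _ _ _] := split (stem b n); exact: cl.
- by have [_ _ sm _ _] := split (stem b n); have := sm (b n); rewrite size_stem.
Qed.

Lemma scheme_branch_nbhs b x O : (forall n, U (stem b n) x) -> nbhs x O ->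
  exists n, U (stem b n) `<=` O.
Proof.
move=> bx /(dev_nbhs _ dev)[n [P Px PO]]; exists n.+1; apply: PO.
  have [_ /(_ (stem b n))[_ _ sm _ _]] := schemeU.
  by have := sm (b n); rewrite size_stem.
by exists x; split; [exact: bx|exact: nbhs_singleton].
Qed.

Lemma scheme_branch_unique b x y : (forall n, U (stem b n) x) ->
  (forall n, U (stem b n) y) -> x = y.
Proof.
move=> bx byy; apply: contrapT => /eqP /T1[O [Oopen /set_mem Ox /set_mem]].
apply; have [n] := scheme_branch_nbhs _ _ _ bx (open_nbhs_nbhs (conj Oopen Ox)).
by apply; exact: byy.
Qed.

(** The nodes of the various levels containing x are unique, hence extend each
    other, and their last entries form the branch. *)
Lemma scheme_address x : scheme_set U x -> exists b, forall n, U (stem b n) x.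
Proof.
move=> Fx.
have /choice[s sP] : forall n, exists s, size s = n /\ U s x.
  by move=> n; have [s sn Usx] := Fx n I; exists s.
exists (fun n => head 0%N (s n.+1)).
suff eq_s n : stem (fun n => head 0%N (s n.+1)) n = s n.
  by move=> n; rewrite eq_s; have [] := sP n.
elim: n => [|n IH] /=; first by have [/size0nil] := sP 0%N.
rewrite IH; have [] := sP n.+1; case: (s n.+1) => //= i t [tn] Uitx.
have [sn Usx] := sP n; congr cons; apply: (@scheme_inj _ _ x) => //.
  by rewrite sn tn.
exact: scheme_sub Uitx.
Qed.

Lemma scheme_set_branch b x : (forall n, U (stem b n) x) -> scheme_set U x.
Proof. by move=> bx n _; exists (stem b n) => //=; exact: size_stem. Qed.

Lemma scheme_set_Gdelta : Gdelta (scheme_set U).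
Proof.
exists (fun n => \bigcup_(s in [set s | size s = n]) U s) => // n.
by apply: bigcup_open => s _; exact: scheme_open.
Qed.

(** Inside O choose a neighbourhood P of a point such that every sufficiently
    small set meeting P lies in O. Some node of a deep level meets P, hence is
    contained in O, and the limit of any branch through that node is the required
    point. *)
Lemma scheme_set_dense : dense (scheme_set U).
Proof.
move=> O [x Ox] Oopen.
have [n [P Px PO]] := dev_nbhs _ dev x O (open_nbhs_nbhs (conj Oopen Ox)).
have [|s sn [y [Py Usy]]] := scheme_level_dense n.+1 _ (open_interior P).
  by exists x.
have [b bs] := stem_surj s; rewrite sn in bs.
have [z bz] := scheme_branch b; exists z; split.
  apply: (PO (U s)); last by rewrite -bs; exact: bz.
    have [_ split] := schemeU; case: s sn {Usy bs} => //= i s [<-].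
    by have [_ _ sm _ _] := split s; exact: sm.
  by exists y; split => //; exact: interior_subset Py.
exact: scheme_set_branch bz.
Qed.

Lemma nbhs_cylinder (b : baire_space) n :
  nbhs b [set c : baire_space | stem c n = stem b n].
Proof.
elim: n => [|n IH]; first exact: filterS filterT.
have bn : nbhs b [set c : baire_space | c n = b n].
  have /(_ [set b n]) := @proj_continuous nat (fun=> nat) n b.
  by apply; apply: open_nbhs_nbhs; split=> //; exact: discrete_open.
by apply: filterS (filterI IH bn) => c [/= -> ->].
Qed.

Lemma continuous_baire (S : topologicalType) (g : S -> baire_space) :
  (forall x n, nbhs x [set y | g y n = g x n]) -> continuous g.
Proof.
move=> gP x; apply/cvg_sup => n A [_ [[B Bopen <-] Bx BA]].
by apply: filterS (gP x n) => y /= gy; apply: BA; rewrite /= gy.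
Qed.

Lemma scheme_homeomorphism :
  exists h : baire_space -> scheme_set U, homeomorphism h /\
    forall b n, U (stem b n) (set_val (h b)).
Proof.
have /choice[h hP] : forall b : baire_space, exists x : scheme_set U,
    forall n, U (stem b n) (set_val x).
  move=> b; have [x bx] := scheme_branch b.
  by exists (SigSub (mem_set (scheme_set_branch _ _ bx))).
have /choice[g gP] : forall x : scheme_set U, exists b : baire_space,
    forall n, U (stem b n) (set_val x).
  by move=> x; apply: scheme_address; exact: set_valP.
exists h; split=> //; split.
  move=> b A [_ [[O Oopen <-] Ob OA]].
  have [n nO] := scheme_branch_nbhs _ _ _ (hP b)
    (open_nbhs_nbhs (conj Oopen Ob)).
  apply: filterS (nbhs_cylinder b n) => c /= cb; apply: OA; apply: nO.
  by rewrite -cb; exact: hP.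
exists g; split.
- apply: continuous_baire => x n.
  exists (set_val @^-1` U (stem (g x) n.+1)); split.
  + by exists (U (stem (g x) n.+1)) => //; exact: scheme_open.
  + exact: gP.
  + move=> y /= Uy; suff : stem (g y) n.+1 = stem (g x) n.+1 by case.
    by apply: (scheme_inj _ _ _ _ (gP y n.+1) Uy); rewrite /= !size_stem.
- move=> b; apply/funext => n.
  suff : stem (g (h b)) n.+1 = stem b n.+1 by case.
  apply: (scheme_inj _ _ _ _ (gP (h b) n.+1) (hP b n.+1)).
  by rewrite !size_stem.
- move=> x; apply: val_inj.
  exact: scheme_branch_unique _ _ _ (hP (g x)) (gP x).
Qed.

End SchemeHomeomorphism.

(** * Splitting nonempty open sets into dense families *)

Section GreedySplitting.
Context {T : topologicalType} {small : nat -> set T -> Prop}.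
Variable B : nat -> set T.
Hypothesis Bbase : pi_base B.

(** W k is what remains of U after removing the closures of u 0, ..., u (k-1).
    A nonempty open subset of U that misses W k is covered by these closures, so
    it meets one of the sets themselves. A basic set B k therefore meets some u i with
    i < k, or else it meets W k and then contains u k. *)
Lemma greedy_splits n (U : set T) (u W : nat -> set T) :
  open U -> W 0%N = U -> (forall k, W k.+1 = W k `\` closure (u k)) ->
  (forall k,
    [/\ open (u k), u k !=set0, closure (u k) `<=` W k & small n (u k)]) ->
  (forall k, B k `&` W k !=set0 -> u k `<=` B k) ->
  splits small n U u.
Proof.
move=> Uopen W0 WS uP uB.
have Wmono m k : (m <= k)%N -> W k `<=` W m.
  move=> /subnK <-; elim: (k - m)%N => [|i IH] //.
  by apply: subset_trans IH; rewrite addSn WS; exact: subDsetl.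
have uW k : u k `<=` W k.
  by have [_ _ + _] := uP k; apply: subset_trans; exact: subset_closure.
have disj i j : (i < j)%N -> u i `&` u j !=set0 -> False.
  move=> ij [x [ui uj]]; have := Wmono _ _ ij _ (uW _ _ uj).
  by rewrite WS => -[_]; apply; exact: subset_closure.
have meets k O : open O -> O !=set0 -> O `<=` U -> O `&` W k = set0 ->
    exists i, O `&` u i !=set0.
  move=> Oopen [x Ox] OU; elim: k => [|k IH] OW.
    by have : (O `&` W 0%N) x; [rewrite W0; split=> //; exact: OU|rewrite OW].
  have [/IH//|/eqP/set0P[z [Oz Wz]]] := EM (O `&` W k = set0).
  have clz : closure (u k) z.
    apply: contrapT => nz; have : (O `&` W k.+1) z by rewrite WS.
    by rewrite OW.
  have [y [uy Oy]] := clz _ (open_nbhs_nbhs (conj Oopen Oz)).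
  by exists k, y.
split.
- by move=> i; have [] := uP i.
- move=> i; have [_ _ uW0 _] := uP i; rewrite -W0.
  exact: subset_trans uW0 (Wmono _ _ (leq0n i)).
- by move=> i; have [] := uP i.
- move=> i j uij; case: (ltngtP i j) => // ij; exfalso.
    exact: disj ij uij.
  by apply: disj ij _; rewrite setIC.
- move=> O Oopen OU0.
  have [k [Bk0 BkOU]] := Bbase.2 _ (openI Oopen Uopen) OU0.
  have [BW|/eqP/set0P BW] := EM (B k `&` W k = set0).
    have BU : B k `<=` U by move=> x /BkOU[].
    have [i [x [Bx ux]]] := meets k (B k) (Bbase.1 k) Bk0 BU BW.
    by exists i, x; split=> //; have [] := BkOU x Bx.
  have [_ [x ux] _ _] := uP k; exists k, x; split=> //.
  by have [] := BkOU x (uB k BW x ux).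
Qed.

End GreedySplitting.

Lemma perfect_other_point (T : topologicalType) (W : set T) x :
  perfect_space T -> open W -> W x -> exists2 y, W y & y != x.
Proof.
move=> perf Wopen Wx; apply: contrapT => noy.
have : isolated [set: T] x.
  split; first exact: mem_set.
  exists W; first exact: open_nbhs_nbhs.
  rewrite setIT; apply/seteqP; split=> [y Wy|_ ->//].
  by apply: contrapT => /eqP yx; apply: noy; exists y.
by rewrite perf.
Qed.

(** W has a point y other than x; a neighbourhood of x whose closure misses y
    leaves y in the remaining region. *)
Lemma shrink_leaving_room {T : topologicalType} {small : nat -> set T -> Prop}
    n (W O : set T) x :
  accessible_space T -> complete_development small -> perfect_space T ->
  open W -> W x -> nbhs x O ->
  exists u, [/\ [/\ open u, u !=set0, closure u `<=` O & small n u],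
    u `<=` O & W `\` closure u !=set0].
Proof.
move=> T1 dev perf Wopen Wx Ox.
have [y Wy yx] := perfect_other_point _ _ _ perf Wopen Wx.
have Oyx : nbhs x (O `&` ~` [set y]).
  apply: filterI Ox _; apply: open_nbhs_nbhs; split.
    by apply: closed_openC; exact: accessible_closed_set1.
  by move=> /= xy; rewrite xy eqxx in yx.
have [u [uopen ux ucl usmall]] := dev_shrink _ dev n _ _ Oyx.
exists u; split.
- split=> //; first by exists x.
  by apply: subset_trans ucl _; exact: subIsetl.
- by move=> z /subset_closure /ucl[].
- by exists y; split=> // /ucl[_]; apply.
Qed.

(** * Simultaneous schemes in the two factors *)

Section PairSplitting.
Variables (X Y : topologicalType).
Variables (smallX : nat -> set X -> Prop) (smallY : nat -> set Y -> Prop).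
Variables (BX : nat -> set X) (BY : nat -> set Y).
Hypotheses (T1X : accessible_space X) (T1Y : accessible_space Y).
Hypotheses (devX : complete_development smallX)
  (devY : complete_development smallY).
Hypotheses (baseX : pi_base BX) (baseY : pi_base BY).
Hypotheses (perfectX : perfect_space X) (perfectY : perfect_space Y).

Let room (WZ : set X * set Y) : Prop :=
  [/\ open WZ.1, WZ.1 !=set0, open WZ.2 & WZ.2 !=set0].

(** The next piece is sought inside the basic set B whenever B still meets the
    remaining region W; this is what makes the pieces dense in the end. *)
Let aim {T : topologicalType} (B W : set T) : set T :=
  if pselect (B `&` W !=set0) then B `&` W else W.

Let aimP (T : topologicalType) (B W : set T) : open B -> open W -> W !=set0 ->
  [/\ open (aim B W), aim B W !=set0, aim B W `<=` W &
      B `&` W !=set0 -> aim B W `<=` B].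
Proof.
move=> Bopen Wopen W0; rewrite /aim; case: pselect => BW; split=> //.
- exact: openI.
- exact: subIsetr.
- by move=> _; exact: subIsetl.
Qed.

Lemma pair_step n (E : set (X * Y)) (B W : set X) (C Z : set Y) :
  open E -> dense E -> open B -> open C ->
  open W -> W !=set0 -> open Z -> Z !=set0 ->
  exists uv : set X * set Y,
    [/\ [/\ open uv.1, uv.1 !=set0, closure uv.1 `<=` W & smallX n uv.1],
        [/\ open uv.2, uv.2 !=set0, closure uv.2 `<=` Z & smallY n uv.2],
        (B `&` W !=set0 -> uv.1 `<=` B) /\ (C `&` Z !=set0 -> uv.2 `<=` C),
        W `\` closure uv.1 !=set0 /\ Z `\` closure uv.2 !=set0 &
        uv.1 `*` uv.2 `<=` E].
Proof.
move=> Eopen Edense Bopen Copen Wopen W0 Zopen Z0.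
have [W1open [w W1w] W1W W1B] := aimP _ _ _ Bopen Wopen W0.
have [Z1open [z Z1z] Z1Z Z1C] := aimP _ _ _ Copen Zopen Z0.
have [||[x y] [[/= W1x Z1y] Exy]] := Edense (aim B W `*` aim C Z).
- by exists (w, z).
- rewrite openE => -[s t] [/= W1s Z1t].
  by exists (aim B W, aim C Z) => //; split; exact: open_nbhs_nbhs.
have [[P Q] /= [Px Qy] PQE] : nbhs (x, y) E by exact: open_nbhs_nbhs.
have nx : nbhs x (P `&` aim B W) by apply: filterI => //; exact: open_nbhs_nbhs.
have ny : nbhs y (Q `&` aim C Z) by apply: filterI => //; exact: open_nbhs_nbhs.
have [u [[uo u0 uc us] uP Wu]] :=
  shrink_leaving_room n _ _ _ T1X devX perfectX Wopen (W1W _ W1x) nx.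
have [v [[vo v0 vc vs] vP Zv]] :=
  shrink_leaving_room n _ _ _ T1Y devY perfectY Zopen (Z1Z _ Z1y) ny.
exists (u, v); split=> //=.
- by split=> // t /uc[_ /W1W].
- by split=> // t /vc[_ /Z1Z].
- by split=> [/W1B BW t /uP[_ /BW]|/Z1C CZ t /vP[_ /CZ]].
- by move=> [s t] /= [/uP[Ps _] /vP[Qt _]]; exact: PQE.
Qed.

Lemma pair_splits n (E : set (X * Y)) (U : set X) (V : set Y) :
  open E -> dense E -> open U -> U !=set0 -> open V -> V !=set0 ->
  exists uv : nat -> set X * set Y,
    [/\ splits smallX n U (fun i => (uv i).1),
        splits smallY n V (fun i => (uv i).2) &
        forall i, (uv i).1 `*` (uv i).2 `<=` E].
Proof.
move=> Eopen Edense Uopen U0 Vopen V0.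
(* The choice of the next pair is made a total function of the stage and of the
   remaining regions, so that the sequence can be defined by recursion. *)
have /choice[step stepP] : forall kWZ : nat * (set X * set Y),
    exists uv : set X * set Y, room kWZ.2 ->
    [/\ [/\ open uv.1, uv.1 !=set0, closure uv.1 `<=` kWZ.2.1 & smallX n uv.1],
        [/\ open uv.2, uv.2 !=set0, closure uv.2 `<=` kWZ.2.2 & smallY n uv.2],
        (BX kWZ.1 `&` kWZ.2.1 !=set0 -> uv.1 `<=` BX kWZ.1) /\
        (BY kWZ.1 `&` kWZ.2.2 !=set0 -> uv.2 `<=` BY kWZ.1),
        kWZ.2.1 `\` closure uv.1 !=set0 /\ kWZ.2.2 `\` closure uv.2 !=set0 &
        uv.1 `*` uv.2 `<=` E].
  move=> [k [W Z]] /=.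
  have [[/= Wo W0 Zo Z0]|nroom] := EM (room (W, Z)); last first.
    by exists (set0, set0).
  have [uv uvP] := pair_step n E (BX k) W (BY k) Z Eopen Edense
    (baseX.1 k) (baseY.1 k) Wo W0 Zo Z0.
  by exists uv.
pose fix WZ k : set X * set Y := if k is m.+1 then
  ((WZ m).1 `\` closure (step (m, WZ m)).1,
   (WZ m).2 `\` closure (step (m, WZ m)).2) else (U, V).
have WZroom k : room (WZ k).
  elim: k => [|k IH] //=; have [_ _ _ [Wk Zk] _] := stepP (k, WZ k) IH.
  have [Wo _ Zo _] := IH.
  split=> //=; rewrite setDE; apply: openI => //; apply: closed_openC;
    exact: closed_closure.
have {}stepP k := stepP (k, WZ k) (WZroom k).
exists (fun k => step (k, WZ k)); split.
- apply: (greedy_splits _ baseX _ _ _ (fun k => (WZ k).1)) => // k.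
    by have [] := stepP k.
  by have [_ _ [uB _] _ _] := stepP k.
- apply: (greedy_splits _ baseY _ _ _ (fun k => (WZ k).2)) => // k.
    by have [] := stepP k.
  by have [_ _ [_ vB] _ _] := stepP k.
- by move=> k; have [] := stepP k.
Qed.

Lemma pair_schemes (E : nat -> set (X * Y)) :
  [set: X] !=set0 -> [set: Y] !=set0 ->
  (forall n, open (E n)) -> (forall n, dense (E n)) ->
  exists (U : seq nat -> set X) (V : seq nat -> set Y),
    [/\ dense_scheme smallX U, dense_scheme smallY V &
        forall i s, U (i :: s) `*` V (i :: s) `<=` E (size s)].
Proof.
move=> X0 Y0 Eopen Edense.
have /choice[child childP] : forall nUV : nat * (set X * set Y),
    exists uv : nat -> set X * set Y, room nUV.2 ->
    [/\ splits smallX nUV.1 nUV.2.1 (fun i => (uv i).1),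
        splits smallY nUV.1 nUV.2.2 (fun i => (uv i).2) &
        forall i, (uv i).1 `*` (uv i).2 `<=` E nUV.1].
  move=> [n [U V]] /=.
  have [[/= Uo U0 Vo V0]|nroom] := EM (room (U, V)).
    have [uv uvP] := pair_splits n (E n) U V (Eopen n) (Edense n) Uo U0 Vo V0.
    by exists uv.
  by exists (fun=> (set0, set0)).
pose fix UV s : set X * set Y := if s is i :: t then child (size t, UV t) i
  else ([set: X], [set: Y]).
have UVroom s : room (UV s).
  elim: s => [|i s IH] /=; first by split=> //; exact: openT.
  have [splitU splitV _] := childP (size s, UV s) IH.
  have [/(_ i)[? ?] _ _ _ _] := splitU.
  have [/(_ i)[? ?] _ _ _ _] := splitV.
  by split.
have {}childP s := childP (size s, UV s) (UVroom s).
exists (fun s => (UV s).1), (fun s => (UV s).2); split.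
- by split=> // s; have [] := childP s.
- by split=> // s; have [] := childP s.
- by move=> i s; have [_ _] := childP s; exact.
Qed.

End PairSplitting.

Theorem mainTheorem8 (R : realType) (X Y : topologicalType)
    (X0 : [set: X] !=set0) (Y0 : [set: Y] !=set0)
    (polishX : polish R X) (polishY : polish R Y)
    (perfectX : perfect_space X) (perfectY : perfect_space Y)
    (A : set (X * Y)) (denseA : dense A) (GdeltaA : Gdelta A) :
  exists (F : set X) (G : set Y) (f : F -> G),
    [/\ dense F /\ Gdelta F,
        dense G /\ Gdelta G,
        homeomorphism f,
        (forall x : F, A (set_val x, set_val (f x))) &
        homeomorphic F baire_space].
Proof.
have [T1X [smallX devX] [BX baseX]] := polish_development R X X0 polishX.
have [T1Y [smallY devY] [BY baseY]] := polish_development R Y Y0 polishY.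
have [E Eopen AE] := GdeltaA.
have Edense n : dense (E n).
  move=> O O0 Oopen; have [z [Oz]] := denseA O O0 Oopen.
  by rewrite AE => /(_ n I) Ez; exists z.
have [U [V [schemeU schemeV UVE]]] := pair_schemes _ _ _ _ _ _ T1X T1Y devX devY
  baseX baseY perfectX perfectY E X0 Y0 Eopen Edense.
have [h [[h_cont [h' [h'_cont hK h'K]]] hU]] :=
  scheme_homeomorphism T1X devX X0 _ schemeU.
have [k [[k_cont [k' [k'_cont kK k'K]]] kV]] :=
  scheme_homeomorphism T1Y devY Y0 _ schemeV.
exists (scheme_set U), (scheme_set V), (k \o h'); split.
- split; first exact: scheme_set_dense devX X0 _ schemeU.
  exact: scheme_set_Gdelta _ schemeU.
- split; first exact: scheme_set_dense devY Y0 _ schemeV.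
  exact: scheme_set_Gdelta _ schemeV.
- split.
    by move=> x; apply: continuous_comp; [exact: h'_cont|exact: k_cont].
  exists (h \o k'); split.
  + by move=> y; apply: continuous_comp; [exact: k'_cont|exact: h_cont].
  + by move=> x /=; rewrite kK h'K.
  + by move=> y /=; rewrite hK k'K.
- move=> x; rewrite AE => n _; rewrite -(size_stem (h' x) n).
  apply: (UVE (h' x n)); split => /=.
    by have := hU (h' x) n.+1; rewrite h'K.
  exact: kV (h' x) n.+1.
- by exists h'; split=> //; exists h; split.
Qed.
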